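(* Let $\mathfrak{M}$ be a von Neumann algebra and let $A\in\mathfrak{M}$ be nonzero and positive. For any $T\in\mathfrak{M}^A$, the $A$-spectrum $\sigma_A(T)$ is a nonempty compact subset of $\mathbb{C}$.
   Context: $\mathfrak{M}$ acts on a complex Hilbert space $\mathcal{H}$ and contains the identity $I$. For $h\in\mathcal{H}$ put $\|h\|_A=\sqrt{\langle Ah,h\rangle}$, for $T\in\mathfrak{M}$ put $\|T\|_A=\sup\{\|Th\|_A:\|h\|_A=1\}$, and set $\mathfrak{M}^A=\{T\in\mathfrak{M}:\|T\|_A<\infty\}$. $T\in\mathfrak{M}^A$ is $A$-invertible in $\mathfrak{M}^A$ if there is $S\in\mathfrak{M}^A$ with $ATS=AST=A$; the $A$-spectrum is $\sigma_A(T)=\{\lambda\in\mathbb{C}:\lambda I-T\text{ is not }A\text{-invertible in }\mathfrak{M}^A\}$. *)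

(* Defs.v *)
From HB Require Import structures.
From mathcomp Require Import all_boot all_order all_algebra.
From mathcomp Require Import sesquilinear complex.
From mathcomp Require Import all_classical all_reals all_analysis.

Set Implicit Arguments.
Unset Strict Implicit.
Unset Printing Implicit Defensive.

Import Order.TTheory GRing.Theory Num.Theory.
Import numFieldNormedType.Exports.

Local Open Scope classical_set_scope.
Local Open Scope ring_scope.
Local Open Scope complex_scope.

(* A complex Hilbert space is a complete normed space over [R[i]] whose norm
   comes from an inner product.  A form [{dot H for _}] is linear in its first
   argument and conjugate-linear in its second one. *)
Definition hilbert_norm (R : realType) (H : completeNormedModType R[i])
    (dot : {dot H for Num.conj}) : Prop :=
  forall h : H, `|h| ^+ 2 = dot h h.

Definition bounded_op (R : realType) (H : normedModType R[i]) : set (H -> H) :=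
  [set T | linear T /\ continuous T].

Definition is_adjoint (R : realType) (H : lmodType R[i])
    (dot : {dot H for Num.conj}) (T S : H -> H) : Prop :=
  forall x y : H, dot (T x) y = dot x (S y).

(* [0 <= z] in [R[i]] says that [z] is real and nonnegative. *)
Definition positive_op (R : realType) (H : lmodType R[i])
    (dot : {dot H for Num.conj}) (T : H -> H) : Prop :=
  forall h : H, 0 <= dot (T h) h.

Definition matrix_coef (R : realType) (H : lmodType R[i])
    (dot : {dot H for Num.conj}) (T : H -> H) : {ptws H * H -> R[i]^o} :=
  fun p => dot (T p.1) p.2.

(* The weak operator topology, on all maps [H -> H]: the coarsest topology for
   which every [T |-> <T x, y>] is continuous. *)
Definition wot (R : realType) (H : lmodType R[i]) (dot : {dot H for Num.conj}) :=
  initial_topology (matrix_coef dot).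
HB.instance Definition _ (R : realType) (H : lmodType R[i])
    (dot : {dot H for Num.conj}) := Topological.on (wot dot).

Record von_neumann_algebra (R : realType) (H : normedModType R[i])
    (dot : {dot H for Num.conj}) (M : set (H -> H)) : Prop := {
  vna_bounded : M `<=` @bounded_op R H;
  vna_id : M idfun;
  vna_add : forall S T, M S -> M T -> M (S + T);
  vna_scale : forall (a : R[i]) T, M T -> M (a *: T);
  vna_comp : forall S T, M S -> M T -> M (S \o T);
  vna_adjoint : forall T, M T -> exists2 S, M S & is_adjoint dot T S;
  (* [M] is closed in B(H) for the relative weak operator topology *)
  vna_closed : @bounded_op R H `&` closure (M : set (wot dot)) `<=` M
}.

(* [Re] is harmless: [dot (A h) h] is real when [A] is positive. *)
Definition Anorm (R : realType) (H : lmodType R[i])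
    (dot : {dot H for Num.conj}) (A : H -> H) (h : H) : R :=
  Num.sqrt (complex.Re (dot (A h) h)).

Definition Aopnorm (R : realType) (H : lmodType R[i])
    (dot : {dot H for Num.conj}) (A T : H -> H) : \bar R :=
  ereal_sup [set (Anorm dot A (T h))%:E | h in [set h | Anorm dot A h = 1]].

Definition Abounded (R : realType) (H : lmodType R[i])
    (dot : {dot H for Num.conj}) (M : set (H -> H)) (A : H -> H) :
    set (H -> H) :=
  [set T | M T /\ (Aopnorm dot A T < +oo)%E].

Definition Ainvertible (R : realType) (H : lmodType R[i])
    (dot : {dot H for Num.conj}) (M : set (H -> H)) (A T : H -> H) : Prop :=
  exists2 S, Abounded dot M A S & A \o T \o S = A /\ A \o S \o T = A.

Definition Aspectrum (R : realType) (H : lmodType R[i])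
    (dot : {dot H for Num.conj}) (M : set (H -> H)) (A T : H -> H) :
    set R[i]^o :=
  [set l | ~ Ainvertible dot M A (l *: (idfun : H -> H) - T)].

(* Main.v *)
From HB Require Import structures.
Require Import Defs.
From mathcomp Require Import all_boot all_order all_algebra.
From mathcomp Require Import sesquilinear complex.
From mathcomp Require Import all_classical all_reals all_analysis.
From mathcomp Require Import ring lra.
Import Order.TTheory GRing.Theory Num.Theory.
Import numFieldNormedType.Exports.
Local Open Scope classical_set_scope.
Local Open Scope ring_scope.
Local Open Scope complex_scope.

Set Implicit Arguments.
Unset Strict Implicit.
Unset Printing Implicit Defensive.

(** Write [n x] for the seminorm [Anorm dot A x].  Because [A] is nonzero, an
    element of the algebra with finite [A]-norm satisfies [n (T x) <= c * n x]
    for all [x] ([Aopnorm_finP]); in particular it preserves [ker A], which is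
    the null space of [n].  The [A]-spectrum is thus the spectrum of the class
    of [T] modulo the operators [S] with [A S = 0], and every identity below is
    read modulo [ker A].  The seminorm [n] alone need not be complete on this
    quotient.

    Compactness is obtained from Neumann series.  If [X] in the algebra has
    both operator norm and [A]-norm at most 1/2, then [1 - X] is
    invertible in the algebra and its inverse has finite [A]-norm ([neumann]):
    completeness of the Hilbert space yields the inverse pointwise as the limit
    of the partial sums, and weak closedness keeps it in the algebra.  Taking
    for [X] a small multiple of [T] bounds the spectrum
    ([Aspectrum_bounded]); taking a small multiple of an [A]-inverse of [l - T]
    shows that the complement of the spectrum is open ([Ainvertible_open]).

    Nonemptiness is Liouville's theorem in disguise, but only needs the
    seminorm ([resolvent_contra]).  Suppose that [l - T] has an [A]-inverse
    [S l] for every [l], and let [u l = n (S l h)] for some [h] outside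
    [ker A].  The resolvent identity makes [u] continuous, and [u] tends to
    [0] at infinity, so it has a global maximum, at [l0] say.  But the square of
    [u] is strictly subharmonic, its Laplacian being four times the square of
    the seminorm of the derivative [- S l (S l h)].  Concretely,
    [strict_submean] averages the squares over the four points at distance [t]
    from [l0] in the directions 1, -1, i, -i: the average exceeds the value at
    [l0] by [t ^+ 2 * n (S l0 (S l0 h)) ^+ 2] up to [O(t ^+ 3)], so this
    derivative vanishes modulo [ker A].  Applying [l0 - T] puts [S l0 h] in
    [ker A] as well, so the maximum [u l0] is [0], whereas [u 0] is positive
    because [h] is [- T (S 0 h)] modulo [ker A]. *)

(** * The complex modulus and compact discs *)

Notation cmod := Normc.normc.

Lemma cmodE (R : realType) (z : R[i]) : `|z| = (cmod z)%:C.
Proof. by case: z. Qed.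

Lemma cmod_ge0 (R : realType) (z : R[i]) : 0 <= cmod z.
Proof. by case: z => a b; apply: sqrtr_ge0. Qed.

Lemma sqr_cmod (R : realType) (z : R[i]) :
  cmod z ^+ 2 = complex.Re z ^+ 2 + complex.Im z ^+ 2.
Proof. by case: z => a b /=; rewrite sqr_sqrtr ?addr_ge0 ?sqr_ge0. Qed.

Lemma cmodM (R : realType) (a b : R[i]) : cmod (a * b) = cmod a * cmod b.
Proof. exact: Normc.normcM. Qed.

Lemma cmodR (R : realType) (a : R) : cmod a%:C = `|a|.
Proof. by rewrite /= expr0n /= addr0 sqrtr_sqr. Qed.

Lemma cmod_le_ReIm (R : realType) (a b : R) : cmod (a +i* b) <= `|a| + `|b|.
Proof.
rewrite /= -(@ler_pXn2r _ 2%N)// ?nnegrE ?addr_ge0 ?sqrtr_ge0//.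
rewrite sqr_sqrtr ?addr_ge0 ?sqr_ge0// sqrrD !real_normK ?num_real//.
by rewrite lerD2r lerDl mulrn_wge0// mulr_ge0.
Qed.

Lemma Re_le_cmod (R : realType) (z : R[i]) : `|complex.Re z| <= cmod z.
Proof.
case: z => a b /=; rewrite -[leLHS]sqrtr_sqr ler_wsqrtr ?real_normK ?num_real//.
by rewrite lerDl sqr_ge0.
Qed.

Lemma Im_le_cmod (R : realType) (z : R[i]) : `|complex.Im z| <= cmod z.
Proof.
case: z => a b /=; rewrite -[leLHS]sqrtr_sqr ler_wsqrtr ?real_normK ?num_real//.
by rewrite lerDr sqr_ge0.
Qed.

Lemma nbhs_cmod (R : realType) (l0 : R[i]^o) (P : set R[i]^o) :
  nbhs l0 P <-> exists2 d : R, 0 < d & forall l, cmod (l0 - l) < d -> P l.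
Proof.
split.
  move=> /nbhs_normP[d /= d0 h].
  have dE : (complex.Re d)%:C = d by rewrite RRe_real// ger0_real// ltW.
  exists (complex.Re d); first by rewrite -ltcR dE.
  by move=> l hl; apply: h => /=; rewrite cmodE -dE ltcR.
move=> [d d0 h]; apply/(@nbhs_normP _ R[i]^o);
exists d%:C => /=; first by rewrite ltcR.
by move=> l /=; rewrite cmodE ltcR => /h.
Qed.

Lemma continuous_Complex (R : realType) :
  continuous (fun p : R * R => (p.1 +i* p.2) : R[i]^o).
Proof.
move=> [a b] P /nbhs_cmod[d d0 hP].
have d2 : 0 < d / 2 by rewrite divr_gt0.
exists (ball a (d / 2), ball b (d / 2)); first by split; apply: nbhsx_ballx.
move=> [x y] [/=]; rewrite -!ball_normE /= => hx hy; apply: hP.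
have -> : (a +i* b) - (x +i* y) = (a - x) +i* (b - y) by simpc.
by rewrite (le_lt_trans (cmod_le_ReIm _ _))// [ltRHS]splitr ltrD.
Qed.

Lemma compact_cmod_le (R : realType) (r : R) :
  compact [set z : R[i]^o | cmod z <= r].
Proof.
have cK : compact ((fun p : R * R => (p.1 +i* p.2) : R[i]^o) @`
   (`[-r, r]%classic `*` `[-r, r]%classic)).
  apply: continuous_compact; last by apply: compact_setX; exact: segment_compact.
  by apply: continuous_subspaceT; exact: continuous_Complex.
apply: subclosed_compact cK _; last first.
  move=> z /= zr; exists (complex.Re z, complex.Im z); last by case: z {zr}.
  split; rewrite /= in_itv /= -ler_norml.
    exact: le_trans (Re_le_cmod _) zr.
  exact: le_trans (Im_le_cmod _) zr.
rewrite -openC openE => z /= /negP; rewrite -ltNge => zr.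
apply/nbhs_cmod; exists (cmod z - r); first by rewrite subr_gt0.
move=> l hl /= lr.
have : cmod z <= cmod (z - l) + cmod l.
  by rewrite -[in leLHS](subrK l z); apply: le_normcD.
lra.
Qed.

(** * The seminorm of a positive operator *)

Section seminorm.
Context (R : realType) (H : lmodType R[i]) (dot : {dot H for Num.conj}).
Context (A : {linear H -> H}) (A_pos : positive_op dot A).
Local Notation s x y := (dot (A x) y).
Local Notation n := (Anorm dot A).

Lemma formDl x y z : s (x + y) z = s x z + s y z.
Proof. by rewrite linearD linearDl. Qed.
Lemma formDr x y z : s z (x + y) = s z x + s z y.
Proof. exact: linearDr. Qed.
Lemma formZl a x z : s (a *: x) z = a * s x z.
Proof. by rewrite linearZ linearZl_LR. Qed.
Lemma formZr a x z : s z (a *: x) = a^*%C * s z x.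
Proof. exact: linearZr_LR. Qed.

(** On a complex space positivity forces Hermitian symmetry: the values of the
    form at [x + y] and [x + i y] are real, which fixes the imaginary and the
    real part of the difference. *)
Lemma form_herm x y : s y x = (s x y)^*.
Proof.
have im0 v : complex.Im (s v v) = 0 by apply: ger0_Im; apply: A_pos.
have := im0 (x + y); have := im0 (x + 'i *: y).
rewrite !formDl !formDr !formZl !formZr !raddfD /= !im0.
move: (im0 x) (im0 y).
case: (s x y) => a b; case: (s y x) => c d.
case: (s x x) => x1 x2; case: (s y y) => y1 y2 /=.
move=> e1 e2 h1 h2; congr (_ +i* _); lra.
Qed.

Lemma Anorm_ge0 x : 0 <= n x. Proof. exact: sqrtr_ge0. Qed.

Lemma sqr_Anorm x : n x ^+ 2 = complex.Re (s x x).
Proof. 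
rewrite sqr_sqrtr//; have := A_pos x; rewrite lecE /= => /andP[_]. by [].
Qed.

Lemma sqr_AnormD x y :
  n (x + y) ^+ 2 = n x ^+ 2 + n y ^+ 2 + 2 * complex.Re (s x y).
Proof.
rewrite !sqr_Anorm formDl !formDr !raddfD /=.
rewrite (form_herm x y); case: (s x y) => a b /=; ring.
Qed.

Lemma AnormZ (a : R[i]) x : n (a *: x) = cmod a * n x.
Proof.
apply/eqP; rewrite -(@eqrXn2 _ 2%N)// ?mulr_ge0 ?Anorm_ge0 ?cmod_ge0//.
rewrite exprMn !sqr_Anorm sqr_cmod formZl formZr mulrA.
have: complex.Im (s x x) = 0 by apply: ger0_Im; apply: A_pos.
case: (s x x) => u v /= ->; case: a => a b /=; apply/eqP; ring.
Qed.

Lemma AnormN x : n (- x) = n x.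
Proof.
rewrite -scaleN1r AnormZ (_ : cmod (-1) = 1) ?mul1r//.
by rewrite /= oppr0 expr0n /= addr0 sqrtr_sqr normrN normr1.
Qed.

Lemma AnormC x y : n (x - y) = n (y - x).
Proof. by rewrite -(AnormN (y - x)) opprB. Qed.

(** The form may be degenerate, so the usual choice of multipliers [n y] and
    [n x] in [0 <= n (a x - b y) ^+ 2] says something only when both are
    nonzero.  If [y] is null, the multipliers [Re (s x y)] and [n x ^+ 2]
    show that [Re (s x y)] cannot be positive; likewise if [x] is null. *)
Lemma Re_CauchySchwarz x y : complex.Re (s x y) <= n x * n y.
Proof.
have key (a b : R) : 0 <= a ^+ 2 * n x ^+ 2 + b ^+ 2 * n y ^+ 2
   - 2 * (a * b * complex.Re (s x y)).
  have := sqr_AnormD (a%:C *: x) ((- b)%:C *: y).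
  rewrite !AnormZ !formZl formZr.
  have -> : cmod a%:C * n x = `|a| * n x.
    by rewrite /= expr0n /= addr0 sqrtr_sqr.
  have -> : cmod (- b)%:C * n y = `|b| * n y.
    by rewrite /= expr0n /= addr0 sqrtr_sqr normrN.
  rewrite !exprMn !real_normK ?num_real//.
  case: (s x y) => c d /=.
  have := sqr_ge0 (n (a%:C *: x + (- b)%:C *: y)) => + e.
  rewrite e => /le_trans; apply.
  by rewrite le_eqVlt; apply/orP; left; apply/eqP; ring.
have := Anorm_ge0 x; have := Anorm_ge0 y.
rewrite le_eqVlt => /predU1P[y0|y0]; rewrite le_eqVlt => /predU1P[x0|x0].
- have := key 1 1; rewrite -x0 -y0; lra.
- have := key (complex.Re (s x y)) ((n x)^+2); rewrite -y0.
  case: (lerP (complex.Re (s x y)) 0) => [|h]; first by rewrite mulr0.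
  have : 0 < complex.Re (s x y) ^+ 2 * n x ^+ 2 by rewrite mulr_gt0// exprn_gt0.
  rewrite !expr2; lra.
- have := key ((n y)^+2) (complex.Re (s x y)); rewrite -x0.
  case: (lerP (complex.Re (s x y)) 0) => [|h]; first by rewrite mul0r.
  have : 0 < complex.Re (s x y) ^+ 2 * n y ^+ 2 by rewrite mulr_gt0// exprn_gt0.
  rewrite !expr2; lra.
have := key (n y) (n x).
have xy : 0 < n x * n y by apply: mulr_gt0.
move=> h; rewrite -(ler_pM2l xy); move: h; rewrite !expr2; lra.
Qed.

Lemma AnormD x y : n (x + y) <= n x + n y.
Proof.
rewrite -(@ler_pXn2r _ 2%N)// ?nnegrE ?addr_ge0 ?Anorm_ge0//.
rewrite sqr_AnormD sqrrD; have := Re_CauchySchwarz x y; lra.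
Qed.

(** Multiplying [x] by the conjugate of the form value makes that value real,
    so the bound on real parts suffices. *)
Lemma Anorm_CauchySchwarz x y : cmod (s x y) <= n x * n y.
Proof.
have := Re_CauchySchwarz ((s x y)^* *: x) y.
rewrite formZl AnormZ.
have -> : complex.Re ((s x y)^* * s x y) = cmod (s x y) ^+ 2.
  by rewrite sqr_cmod; case: (s x y) => a b /=; ring.
have -> : cmod (s x y)^* = cmod (s x y).
  by case: (s x y) => a b /=; rewrite sqrrN.
rewrite expr2; have := cmod_ge0 (s x y); rewrite le_eqVlt => /predU1P[<- _|c0].
  by rewrite mulr_ge0 ?Anorm_ge0.
by rewrite -mulrA ler_pM2l.
Qed.

(** The null space of the seminorm is exactly [ker A]: Cauchy-Schwarz against
    the vector [A x] bounds the squared norm of [A x] by [0]. *)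
Lemma Anorm_eq0 x : n x = 0 -> A x = 0.
Proof.
move=> x0; apply/eqP; rewrite -(dnorm_eq0 dot).
have := Anorm_CauchySchwarz x (A x); rewrite x0 mul0r => h.
apply/eqP.
apply: Normc.eq0_normc.
apply/eqP.
by rewrite eq_le h cmod_ge0.
Qed.

(** The seminorm descends to the quotient by [ker A]. *)
Lemma eq_Anorm x y : A x = A y -> n x = n y.
Proof.
move=> e; apply/eqP; rewrite -(@eqrXn2 _ 2%N)// ?Anorm_ge0//.
by rewrite !sqr_Anorm e (form_herm x y) e; case: (s y y).
Qed.

End seminorm.

(** * Resolvents and the maximum principle *)

Section resolvent.
Context (R : realType) (H : lmodType R[i]) (dot : {dot H for Num.conj}).
Context (A : {linear H -> H}) (A_pos : positive_op dot A).
Local Notation n := (Anorm dot A).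

(** Boundedness for the seminorm of [A]; with [idfun] in place of [A] it is
    boundedness for the Hilbert norm, so both norms share one theory. *)
Definition Alip (T : H -> H) (c : R) := forall x, n (T x) <= c * n x.

Lemma Anorm_ker x : A x = 0 -> n x = 0.
Proof. by move=> x0; rewrite /Anorm x0 linear0l /= sqrtr0. Qed.

(** What makes computing modulo [ker A] legitimate: a bounded operator sends
    null vectors of the seminorm to null vectors. *)
Lemma Alip_ker (S : {linear H -> H}) c x y :
  Alip S c -> A x = A y -> A (S x) = A (S y).
Proof.
move=> Sc xy; apply/eqP; rewrite -subr_eq0 -!linearB; apply/eqP.
apply: (Anorm_eq0 A_pos); apply/eqP.
rewrite eq_le Anorm_ge0 andbT (le_trans (Sc _))// (@Anorm_ker (x - y)) ?mulr0//.
by rewrite linearB /= xy subrr.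
Qed.

Lemma parallelogram x y :
  n (x + y) ^+ 2 + n (x - y) ^+ 2 = 2 * (n x ^+ 2 + n y ^+ 2).
Proof.
rewrite !(sqr_AnormD A_pos).
have -> : dot (A x) (- y) = - dot (A x) y by apply: linearNr.
rewrite (AnormN A_pos).
case: (dot (A x) y) => a b /=; ring.
Qed.

(** The heart of nonemptiness.  Here [g z] plays the role of the resolvent at
    [l0 + z] applied to a vector, [v] is its value at [l0], and the equation is
    the resolvent identity.  Iterating it three times gives, modulo [ker A],
    [g z = v - z S v + z^2 S^2 v - z^3 S^3 (g z)], where the bound on [g]
    itself controls the last term.  Since 1, [z] and [z^2] are orthogonal on
    the four points [t], [-t], [i t], [-i t], the squared seminorms of the
    quadratic part sum to
    [4 (n v ^+ 2 + t^2 n (S v) ^+ 2 + t^4 n (S (S v)) ^+ 2)], which is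
    incompatible with a maximum of [n (g z)] at [0] unless [n (S v) = 0]. *)
Lemma strict_submean (S : {linear H -> H}) (c : R) (v : H) (g : R[i] -> H) :
  0 <= c -> Alip S c ->
  (forall z, A (g z) = A (v - z *: S (g z))) ->
  (forall z, n (g z) <= n v) -> A (S v) = 0.
Proof.
move=> c0 Sc gE gv.
have gE3 z : A (g z + z ^+ 3 *: S (S (S (g z)))) =
             A (v - z *: S v + z ^+ 2 *: S (S v)).
  have e1 : A (S (g z)) = A (S v) - z *: A (S (S (g z))).
    by rewrite (Alip_ker Sc (gE z)) !(linearB, linearZ).
  have e2 : A (S (S (g z))) = A (S (S v)) - z *: A (S (S (S (g z)))).
    have : A (S (g z)) = A (S v - z *: S (S (g z))).
      by rewrite e1 !(linearB, linearZ).
    by move/(Alip_ker Sc) ->; rewrite !(linearB, linearZ).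
  rewrite linearD gE linearB [RHS]linearD [A (v - z *: S v)]linearB !linearZ /=.
  rewrite e1 e2.
  rewrite !(scalerN, scalerBr, scalerA) exprSr exprS expr1.
  rewrite !opprB -!addrA; congr (_ + _).
  by rewrite [RHS]addrC; congr (_ + _); rewrite addrCA addNr addr0.
set K := c ^+ 3; have K0 : 0 <= K by rewrite exprn_ge0.
have bnd z : n (v - z *: S v + z ^+ 2 *: S (S v)) <= n v * (1 + cmod z ^+ 3 * K).
  rewrite -(eq_Anorm A_pos (gE3 z)) (le_trans (AnormD A_pos _ _))//.
  rewrite mulrDr mulr1 lerD// (AnormZ A_pos).
  have -> : cmod (z ^+ 3) = cmod z ^+ 3 by rewrite !exprS expr0 !mulr1 !cmodM.
  rewrite mulrCA ler_wpM2l ?exprn_ge0 ?cmod_ge0// mulrC.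
  apply: (le_trans (Sc _)); rewrite /K exprS -mulrA ler_wpM2l//.
  apply: (le_trans (Sc _)); rewrite exprS -mulrA ler_wpM2l//.
  by apply: (le_trans (Sc _)); rewrite expr1 ler_wpM2l.
pose m := n v ^+ 2; pose w := n (S v) ^+ 2.
have m0 : 0 <= m by rewrite sqr_ge0.
have w0 : 0 <= w by rewrite sqr_ge0.
have four t : 0 < t -> t ^+ 2 * w <= m * (2 * t ^+ 3 * K + t ^+ 6 * K ^+ 2).
  move=> t0.
  have sq z : cmod z = t ->
      n (v - z *: S v + z ^+ 2 *: S (S v)) ^+ 2 <= m * (1 + t ^+ 3 * K) ^+ 2.
    move=> zt; have := bnd z; rewrite zt => h.
    have h0 := le_trans (Anorm_ge0 _ _ _) h.
    by rewrite /m -exprMn ler_pXn2r// nnegrE// Anorm_ge0.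
  have tn : cmod t%:C = t by rewrite cmodR gtr0_norm.
  have tin : cmod ('i%C * t%:C) = t.
    by rewrite cmodM tn /= expr0n /= add0r expr1n sqrtr1 mul1r.
  (* The parallelogram law for the opposite points [z] and [- z] removes the
     linear term; the quadratic coefficients left over at [t] and [i t] are
     opposite, so that the same law removes them next. *)
  have pair z : cmod z = t ->
    n (v + z ^+ 2 *: S (S v)) ^+ 2 + t ^+ 2 * w <= m * (1 + t ^+ 3 * K) ^+ 2.
    move=> zt.
    have /sq : cmod (- z) = t by rewrite normcN.
    have := sq _ zt.
    have := parallelogram (v + z ^+ 2 *: S (S v)) (z *: S v).
    rewrite sqrrN scaleNr opprK (AnormZ A_pos z) zt exprMn -/w.
    rewrite addrAC [v + _ + _ in X in _ + X = _ -> _]addrAC; lra.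
  have := pair _ tn; have := pair _ tin.
  have := parallelogram v (t%:C ^+ 2 *: S (S v)).
  have -> : ('i%C * t%:C) ^+ 2 = - t%:C ^+ 2.
    by rewrite exprMn sqr_i mulN1r.
  rewrite scaleNr -/m.
  have := sqr_ge0 (n (t%:C ^+ 2 *: S (S v))).
  have -> : m * (1 + t ^+ 3 * K) ^+ 2 =
    m * (2 * t ^+ 3 * K + t ^+ 6 * K ^+ 2) + m by ring.
  lra.
apply: (Anorm_eq0 A_pos); apply/eqP; rewrite -(@eqrXn2 _ 2%N) ?Anorm_ge0//.
rewrite expr0n /= -/w eq_le w0 andbT leNgt; apply/negP => w_gt0.
(* [L * t] bounds the error term for [t <= 1]; this [t] makes it less
   than [w]. *)
pose L := m * (2 * K + K ^+ 2).
have L0 : 0 <= L by rewrite mulr_ge0// addr_ge0 ?sqr_ge0// mulr_ge0.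
have wL : 0 < w + L by lra.
pose t := w / (w + L).
have t0 : 0 < t by rewrite divr_gt0.
have t1 : t <= 1 by rewrite ler_pdivrMr//; lra.
have : t ^+ 2 * w <= t ^+ 2 * (L * t).
  apply: (le_trans (four _ t0)).
  have -> : t ^+ 2 * (L * t) = m * (2 * t ^+ 3 * K + t ^+ 3 * K ^+ 2).
    by rewrite /L; ring.
  rewrite ler_wpM2l// lerD2l ler_wpM2r ?sqr_ge0//.
  by rewrite (exprD t 3 3) ler_piMr ?exprn_ge0 ?exprn_ile1// ltW.
rewrite ler_pM2l ?exprn_gt0// /t mulrA ler_pdivlMr//.
rewrite mulrC; have : 0 < w * w by rewrite mulr_gt0.
lra.
Qed.

(** The size of an everywhere defined resolvent along a vector [h] would attain
    a global maximum, which [strict_submean] rules out. *)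
Lemma resolvent_contra (T : {linear H -> H}) (cT : R) (h : H) :
  Alip T cT -> A h != 0 ->
  (forall l, exists (S : {linear H -> H}) (c : R), [/\ 0 <= c, Alip S c,
     forall x, A (l *: S x - T (S x)) = A x &
     forall x, A (S (l *: x - T x)) = A x]) -> False.
Proof.
move=> TcT Ah0 /(_ _)/cid-/all_sig[S] /(_ _)/cid-/all_sig[c] Sc.
have c0 l : 0 <= c l by case: (Sc l).
have SL l : Alip (S l) (c l) by case: (Sc l).
have SR l x : A (l *: S l x - T (S l x)) = A x by case: (Sc l).
have SLe l x : A (S l (l *: x - T x)) = A x by case: (Sc l).
have nh0 : 0 < n h.
  rewrite lt_neqAle Anorm_ge0 andbT eq_sym.
  by apply: contra Ah0 => /eqP/(Anorm_eq0 A_pos) ->.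
pose f l := S l h; pose u l := n (f l).
have fE l z : A (f (l + z)) = A (f l - z *: S l (f (l + z))).
  have : A (S l ((l + z) *: f (l + z) - T (f (l + z)))) = A (f l).
    by apply: (Alip_ker (SL l)); rewrite SR.
  rewrite scalerDl addrAC linearD linearD /= SLe => e.
  rewrite !linearZ /= in e.
  by rewrite linearB linearZ /= -e addrK.
have AnB x y : n x - n y <= n (x - y).
  by rewrite lerBlDr -[in leLHS](subrK y x); apply: AnormD.
(* The difference of the resolvents is [- z S f (l + z)], which gives
   continuity once [z] is small enough to absorb [u (l + z)] on the right. *)
have udiff l z : `|u (l + z) - u l| <= cmod z * c l * u (l + z).
  have nd : n (f (l + z) - f l) <= cmod z * c l * u (l + z).
    rewrite (@eq_Anorm _ _ _ _ A_pos _ (- (z *: S l (f (l + z))))).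
      rewrite (AnormN A_pos) (AnormZ A_pos) -mulrA ler_wpM2l ?cmod_ge0//.
      exact: SL.
    by rewrite linearB /= fE linearB linearN /= addrAC subrr add0r.
  rewrite ler_norml; apply/andP; split.
    by rewrite lerNl opprB (le_trans (AnB _ _))// -(AnormN A_pos) opprB.
  by rewrite (le_trans (AnB _ _)).
have uc : continuous (u : R[i]^o -> R).
  move=> l; apply/(@cvgrPdist_lt _ _ _ (nbhs (l : R[i]^o))) => e e0.
  have u0 : 0 <= u l by apply: Anorm_ge0.
  have K0 : 0 < 1 + 2 * c l * (1 + u l / e).
    by rewrite ltr_pwDl// !mulr_ge0// addr_ge0// divr_ge0// ltW.
  apply/nbhs_cmod.
  (* Within this radius [cmod z * c l <= 1 / 2], whence [u l' <= 2 * u l], and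
     [2 * cmod z * c l * u l < e]. *)
  exists (1 + 2 * c l * (1 + u l / e))^-1; first by rewrite invr_gt0.
  move=> l' hl'.
  have e1 : l + (l' - l) = l' by rewrite addrC subrK.
  have := udiff l (l' - l); rewrite e1 => hd.
  rewrite distrC (le_lt_trans hd)//.
  rewrite -normcN opprB.
  set z := cmod _ in hl' *.
  have z0 : 0 <= z by apply: cmod_ge0.
  have : z * (1 + 2 * c l * (1 + u l / e)) < 1.
    by rewrite -ltr_pdivlMr// div1r.
  have u'0 : 0 <= u l' by apply: Anorm_ge0.
  have hd' : u l' <= u l + z * c l * u l'.
    by move: hd; rewrite -normcN opprB -/z ler_norml => /andP[_]; lra.
  have zc0 : 0 <= z * c l by apply: mulr_ge0.
  have q0 : 0 <= z * c l * (u l / e) by rewrite mulr_ge0// divr_ge0// ltW.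
  move=> small.
  have zc2 : 2 * (z * c l) < 1 by lra.
  have : z * c l * (u l / e) * 2 < 1 by lra.
  rewrite mulrA mulrAC ltr_pdivrMr// mul1r.
  have : u l' * (2 * (z * c l)) <= u l' by rewrite ler_piMr// ltW.
  move=> hu.
  have : z * c l * u l' <= z * c l * (2 * u l) by rewrite ler_wpM2l//; lra.
  lra.
have u0 : 0 < u 0.
  have e : A h = A (- T (f 0)) by rewrite -(SR 0 h) scale0r add0r.
  rewrite lt_neqAle Anorm_ge0 andbT; apply: contraTneq nh0 => u00.
  rewrite (eq_Anorm A_pos e) (AnormN A_pos) -leNgt (le_trans (TcT _))//.
  by rewrite -[n (f 0)]u00 mulr0.
(* [(cmod l - cT) * u l <= n h], so beyond this radius [u] is at most
   [u 0]. *)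
pose rho := `|cT| + 1 + n h / u 0.
have rho0 : cmod (0 : R[i]) <= rho.
  by rewrite Normc.normc0 /rho !addr_ge0// divr_ge0// ltW.
have decay l : rho < cmod l -> u l <= u 0.
  move=> hl.
  have : cmod l * u l - cT * u l <= n h.
    rewrite -(eq_Anorm A_pos (SR l h)) -(AnormZ A_pos).
    by rewrite (le_trans _ (AnB _ _))// lerB// TcT.
  rewrite -mulrBl => h1.
  have h2 : (n h / u 0) * u l <= n h.
    apply: le_trans h1; rewrite ler_wpM2r ?Anorm_ge0//.
    by have := ler_norm cT; rewrite /rho in hl; lra.
  by move: h2; rewrite mulrAC ler_pdivrMr// ler_pM2l.
have [l0 _ l0max] : exists2 l0, l0 \in [set z : R[i]^o | cmod z <= rho] &
    forall t, t \in [set z : R[i]^o | cmod z <= rho] -> u t <= u l0.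
  apply: compact_EVT_max; last by apply: continuous_subspaceT.
    by exists 0.
  exact: compact_cmod_le.
have u0max l : u l <= u l0.
  have [hl|hl] := lerP (cmod l) rho; first by apply: l0max; rewrite inE.
  by apply: (le_trans (decay _ hl)); apply: l0max; rewrite inE.
have Sv0 : A (S l0 (f l0)) = 0.
  exact: (strict_submean (c0 l0) (SL l0) (fE l0) (fun z => u0max (l0 + z))).
have Sv0' : A (S l0 (f l0)) = A 0 by rewrite Sv0 linear0.
have : A (f l0) = 0.
  rewrite -(SR l0 (f l0)) linearB linearZ /= Sv0.
  by rewrite (Alip_ker TcT Sv0') !linear0 addr0.
move=> /Anorm_ker ul0; have := u0max 0.
by rewrite /u ul0 -/(u 0) leNgt u0.
Qed.
End resolvent.

(** * Closedness of the algebra and Neumann series *)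

(** Elements of the algebra come as bare functions with a proof of linearity;
    packing them gives access to the theory of linear maps. *)
Lemma linear_packed (R : realType) (H : lmodType R[i]) (T : H -> H) :
  linear T -> exists T' : {linear H -> H}, T = T'.
Proof.
move=> linT.
pose T' : {linear H -> H} :=
  HB.pack T (GRing.isLinear.Build R[i] H H *:%R T linT).
by exists T'.
Qed.

Section hilbert.
Context (R : realType) (H : completeNormedModType R[i]).
Context (dot : {dot H for Num.conj}) (dot_norm : hilbert_norm dot).
Local Notation N := (Anorm dot idfun).

Lemma idfun_pos : positive_op dot (idfun : {linear H -> H}).
Proof. by move=> h; apply: dnorm_ge0. Qed.

Lemma norm_AnormE h : `|h| = (N h)%:C.
Proof.
have r0 : (complex.Re `|h|)%:C = `|h| by rewrite RRe_real// normr_real.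
rewrite -r0; congr (_%:C).
rewrite /Anorm -dot_norm -r0 -rmorphXn /= sqrtr_sqr ger0_norm//.
by rewrite -ler0c r0.
Qed.

Lemma bounded_opP (T : {linear H -> H}) :
  bounded_op T <-> exists2 c, 0 <= c & Alip dot idfun T c.
Proof.
split.
  move=> [_ /linear_bounded_continuous/linear_boundedP].
  move=> /pinfty_ex_gt0 [M M0 TM].
  have ME : (complex.Re M)%:C = M by rewrite RRe_real// ger0_real// ltW.
  exists (complex.Re M); first by rewrite -ler0c ME ltW.
  by move=> x; rewrite -lecR rmorphM /= ME -!norm_AnormE.
move=> [c c0 Tc]; split; first by move=> a u v; rewrite linearP.
apply/linear_bounded_continuous/linear_boundedP.
exists c%:C; split; first by rewrite ger0_real ?ler0c.
move=> r cr x; rewrite (@le_trans _ _ (c%:C * `|x|))//.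
  by rewrite !norm_AnormE -rmorphM lecR; exact: Tc.
by rewrite ler_wpM2r// ltW.
Qed.

Lemma geometric_small (C d : R) : 0 < d ->
  exists n0, forall n, (n0 <= n)%N -> (1 / 2) ^+ n * C < d.
Proof.
move=> d0.
have h2 : `|1 / 2 : R| < 1 by rewrite ger0_norm; lra.
have /cvgrPdist_lt/(_ _ d0)[n0 _ hn0] := cvg_geometric C h2.
exists n0 => n n0n; have := hn0 _ n0n; rewrite /= sub0r normrN /geometric /= mulrC.
by apply: le_lt_trans; exact: ler_norm.
Qed.

Context (M : set (H -> H)) (vnM : von_neumann_algebra dot M).

(** Weak closedness of the algebra, in the only form used here: along a
    geometrically convergent sequence every matrix coefficient converges. *)
Lemma vna_seq_closed (S : nat -> H -> H) (W : H -> H) :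
  bounded_op W -> (forall n, M (S n)) ->
  (exists2 C : R, 0 <= C &
     forall n x, N (S n x - W x) <= (1 / 2) ^+ n * (C * N x)) ->
  M W.
Proof.
move=> bW MS [C C0 SW]; apply: (vna_closed vnM); split => // B.
have cvgS : (fun n => matrix_coef dot (S n)) @ \oo -->
    (matrix_coef dot W : {ptws H * H -> R[i]^o}).
  apply/cvg_sup => p.
  move=> B1; rewrite nbhsE => -[_ [[V oV <-] VW] VB].
  have /nbhs_cmod[d d0 dV] : nbhs (matrix_coef dot W p : R[i]^o) V.
    exact: open_nbhs_nbhs.
  have [n0 hn0] := geometric_small (C * N p.1 * N p.2) d0.
  exists n0 => // n /hn0 hn; apply: VB; apply: dV.
  rewrite /matrix_coef -[dot (W _) _ - _](linearBl _ p.2) -normcN.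
  have -> : - dot (W p.1 - S n p.1) p.2 = dot (idfun (S n p.1 - W p.1)) p.2.
    by rewrite -linearNl opprB.
  apply: le_lt_trans hn.
  have /le_trans := Anorm_CauchySchwarz idfun_pos (S n p.1 - W p.1) p.2; apply.
  rewrite [leRHS]mulrA ler_wpM2r ?Anorm_ge0//; exact: SW.
rewrite nbhsE => -[_ [[V oV <-] VW] VB].
have : nbhs (matrix_coef dot W : {ptws H * H -> R[i]^o}) V.
  by apply: open_nbhs_nbhs.
move=> /cvgS [n0 _ /(_ n0)/= Vn0].
exists (S n0); split; first exact: MS.
by apply: VB; apply: Vn0 => /=.
Qed.

End hilbert.

Section neumann.
Context (R : realType) (H : completeNormedModType R[i]).
Context (dot : {dot H for Num.conj}) (dot_norm : hilbert_norm dot).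
Local Notation N := (Anorm dot idfun).

Lemma Anorm_id_eq0 x : N x = 0 -> x = 0.
Proof. exact: (Anorm_eq0 (@idfun_pos _ _ dot)). Qed.

Lemma Anorm_idD x y : N (x + y) <= N x + N y.
Proof. exact: (AnormD (@idfun_pos _ _ dot)). Qed.

Lemma Anorm_idC x y : N (x - y) = N (y - x).
Proof. exact: (AnormC (@idfun_pos _ _ dot)). Qed.

Section fixpoint.
Context (X : {linear H -> H}) (X2 : Alip dot idfun X (1 / 2)).

Lemma half_contraction_fixed0 x : x = X x -> x = 0.
Proof.
move=> xX; apply: Anorm_id_eq0; apply/eqP; rewrite eq_le Anorm_ge0 andbT.
have := X2 x; rewrite -xX; lra.
Qed.

(** The partial sums of the Neumann series applied to [h] are the iterates of
    the contraction [y |-> h + X y] from [0], and form a Cauchy sequence. *)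
Lemma half_contraction_affine_fixed h : exists y, y = h + X y.
Proof.
pose s n := iter n (fun y => h + X y) 0.
have s2 n : N (s n) <= 2 * N h.
  elim: n => [|n IH].
    rewrite (_ : N (s 0%N) = 0) ?mulr_ge0 ?Anorm_ge0//.
    by rewrite /Anorm /s /= linear0l /= sqrtr0.
  apply: (le_trans (Anorm_idD _ _)); have := X2 (s n); lra.
have sD n m : N (s (n + m)%N - s n) <= (1 / 2) ^+ n * (2 * N h).
  elim: n => [|n IH]; first by rewrite expr0 mul1r add0n subr0.
  rewrite addSn /= opprD addrACA subrr add0r -linearB /=.
  apply: (le_trans (X2 _)); rewrite exprS -mulrA.
  by rewrite ler_wpM2l//; lra.
have /cauchy_cvgP/cvg_ex[y sy] : cauchy (s @ \oo).
  apply: cauchy_exP => e e0.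
  have eE : (complex.Re e)%:C = e by rewrite RRe_real// ger0_real// ltW.
  have d0 : 0 < complex.Re e by rewrite -ltcR eE.
  have [n0 hn0] := geometric_small (2 * N h) d0.
  exists (s n0), n0 => // n /= n0n.
  rewrite -ball_normE /= (norm_AnormE dot_norm) Anorm_idC -eE ltcR.
  by rewrite -(subnKC n0n) (le_lt_trans (sD _ _))// hn0.
exists y; apply/eqP; rewrite -subr_eq0; apply/eqP/Anorm_id_eq0/eqP.
rewrite eq_le Anorm_ge0 andbT; apply/ler_addgt0Pr => e e0; rewrite add0r.
have e2 : (0 : R[i]) < (e / 2)%:C by rewrite ltcR divr_gt0.
have [n0 _ hn0] := (@cvgrPdist_lt _ _ _ _ _ _ _).1 sy _ e2.
have := hn0 n0 (leqnn _); have := hn0 n0.+1 (leqnSn _).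
rewrite /= !(norm_AnormE dot_norm) !ltcR => h1 h2.
have -> : y - (h + X y) = (y - (h + X (s n0))) + X (s n0 - y).
  by rewrite linearB /= !opprD !addrA subrK.
apply: (le_trans (Anorm_idD _ _)); have := X2 (s n0 - y).
rewrite Anorm_idC in h2; lra.
Qed.
End fixpoint.

Context (M : set (H -> H)) (vnM : von_neumann_algebra dot M).
Context (A : {linear H -> H}) (A_pos : positive_op dot A).

(** The inverse sends [h] to the unique solution of [y = h + X y].  Linearity
    follows from uniqueness, and the same equation bounds [W] by 2 for either
    norm, since [X] is bounded by 1/2 for it: no convergence in the seminorm is
    involved. *)
Lemma neumann (X : {linear H -> H}) : M X ->
  Alip dot idfun X (1 / 2) -> Alip dot A X (1 / 2) ->
  exists W : {linear H -> H}, [/\ M W, Alip dot A W 2,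
    forall x, W x - X (W x) = x & forall x, W (x - X x) = x].
Proof.
move=> MX X2 XA2.
have [W WE] := choice (half_contraction_affine_fixed X2).
have uniq y x : y = x + X y -> y = W x.
  move=> yx; apply/eqP; rewrite -subr_eq0; apply/eqP/(half_contraction_fixed0 X2).
  by rewrite {1}yx {1}(WE x) opprD addrACA subrr add0r linearB.
have linW : linear W.
  move=> a u v; apply/esym/uniq; rewrite linearP /= {1}(WE u) {1}(WE v).
  by rewrite scalerDr addrACA.
have [W' W'E] := linear_packed linW; subst W.
have bndW (B : {linear H -> H}) : positive_op dot B ->
    Alip dot B X (1 / 2) -> Alip dot B W' 2.
  move=> B_pos XB x; have := AnormD B_pos x (X (W' x)).
  rewrite -WE; have := XB (W' x); lra.
have NW2 : Alip dot idfun W' 2 by apply: (bndW idfun) => //; apply: idfun_pos.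
exists W'; split.
- (* Partial sums; the empty one is written as a multiple of the identity,
     which places it in the algebra. *)
  pose S n := iter n (fun S : H -> H => idfun + (X \o S))
                     (0 *: (idfun : H -> H)).
  apply: (vna_seq_closed vnM (S := S)).
  + by apply/(bounded_opP dot_norm); exists 2.
  + elim=> [|n IH] /=; first exact: vna_scale vnM _ _ (vna_id vnM).
    exact: vna_add vnM _ _ (vna_id vnM) (vna_comp vnM MX IH).
  exists 2 => // n x; apply: (@le_trans _ _ ((1 / 2) ^+ n * N (W' x))); last first.
    by rewrite ler_wpM2l// exprn_ge0//; lra.
  elim: n => [|n IH] /=.
    rewrite expr0 mul1r Anorm_idC (_ : (0 *: _ : H -> H) x = 0) ?subr0//.
    by rewrite /GRing.scale /= scale0r.
  rewrite {1}WE [(_ + _) x]/(x + X (S n x)) opprD addrACA subrr add0r -linearB /=.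
  apply: (le_trans (X2 _)); rewrite exprS -mulrA.
  by rewrite ler_wpM2l//; lra.
- exact: bndW.
- by move=> x; rewrite {1}WE addrK.
- by move=> x; apply/esym/uniq; rewrite subrK.
Qed.

End neumann.

(** * The spectrum relative to a positive operator *)

Section Aalgebra.
Context (R : realType) (H : completeNormedModType R[i]).
Context (dot : {dot H for Num.conj}).
Context (A : {linear H -> H}) (A_pos : positive_op dot A).
Context (h0 : H) (Ah0 : A h0 != 0).
Local Notation n := (Anorm dot A).

Lemma Anorm_unit : exists e, n e = 1.
Proof.
have nh0 : 0 < n h0.
  rewrite lt_neqAle Anorm_ge0 andbT eq_sym.
  by apply: contra Ah0 => /eqP/(Anorm_eq0 A_pos) ->.
exists ((n h0)^-1%:C *: h0).
by rewrite (AnormZ A_pos) cmodR gtr0_norm ?invr_gt0// mulVf ?gt_eqF.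
Qed.

(** The supremum only sees vectors with [n x = 1].  A null vector [x] is
    reached by moving a unit vector [e] along it: [n (e + t x) = 1] for all
    [t], so [t * n (T x)] stays bounded and [n (T x) = 0].  A unit vector
    exists because [A] is nonzero. *)
Lemma Aopnorm_finP (T : {linear H -> H}) :
  (Aopnorm dot A T < +oo)%E <-> exists2 c, 0 <= c & Alip dot A T c.
Proof.
split; last first.
  move=> [c c0 Tc]; apply: (@le_lt_trans _ _ c%:E); last exact: ltry.
  apply: ub_ereal_sup => _ [h /= h1 <-].
  by rewrite lee_fin (le_trans (Tc _))// h1 mulr1.
have [e e1] := Anorm_unit.
move=> Toof.
have ub x : n x = 1 -> ((n (T x))%:E <= Aopnorm dot A T)%E.
  by move=> x1; apply: ereal_sup_ubound; exists x.
have [c cE] : exists c : R, Aopnorm dot A T = c%:E.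
  move: Toof (ub _ e1); case: (Aopnorm dot A T) => [c _ _|//|_]; first by exists c.
  by rewrite leeNy_eq.
have {}ub x : n x = 1 -> n (T x) <= c by move/ub; rewrite cE lee_fin.
have c0 : 0 <= c by apply: le_trans (ub _ e1); apply: Anorm_ge0.
exists c => // x.
have := Anorm_ge0 dot A x; rewrite le_eqVlt => /predU1P[x0|x0].
  rewrite -x0 mulr0 leNgt; apply/negP => Tx0.
  pose t := (2 * c + 1) / n (T x).
  have t0 : 0 < t by rewrite divr_gt0//; lra.
  have : n (T (e + t%:C *: x)) <= c.
    apply: ub; rewrite -e1; apply: (eq_Anorm A_pos).
    by rewrite linearD linearZ /= (Anorm_eq0 A_pos (esym x0)) scaler0 addr0.
  have := AnormD A_pos (T (e + t%:C *: x)) (- T e).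
  rewrite (AnormN A_pos) {1}linearD {1}linearZ /= addrAC subrr add0r.
  rewrite (AnormZ A_pos) cmodR gtr0_norm// /t divfK ?gt_eqF//.
  have := ub _ e1; lra.
have : n (T ((n x)^-1%:C *: x)) <= c.
  apply: ub; rewrite (AnormZ A_pos) cmodR gtr0_norm ?invr_gt0//.
  by rewrite mulVf ?gt_eqF.
rewrite linearZ /= (AnormZ A_pos) cmodR gtr0_norm ?invr_gt0//.
by rewrite ler_pdivrMl// mulrC.
Qed.

Context (dot_norm : hilbert_norm dot).
Context (M : set (H -> H)) (vnM : von_neumann_algebra dot M).

(** Neumann series need control of both norms at once, hence a single constant
    for the two. *)
Lemma AboundedP (T : H -> H) : Abounded dot M A T <->
  exists T' : {linear H -> H}, [/\ T = T', M T' & exists2 c, 0 <= c &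
     Alip dot A T' c /\ Alip dot idfun T' c].
Proof.
split.
  move=> [MT]; have [/linear_packed[T' TT'] _] := vna_bounded vnM MT; subst T.
  move=> /Aopnorm_finP[c c0 Tc]; exists T'; split => //.
  have /(bounded_opP dot_norm)[d d0 Td] := vna_bounded vnM MT.
  exists (c + d); rewrite ?addr_ge0//; split => x.
    by apply: (le_trans (Tc x)); rewrite ler_wpM2r ?Anorm_ge0// lerDl.
  by apply: (le_trans (Td x)); rewrite ler_wpM2r ?Anorm_ge0// lerDr.
move=> [T' [-> MT [c c0 [Tc _]]]]; split => //.
by apply/Aopnorm_finP; exists c.
Qed.

Lemma Abounded_intro (T : {linear H -> H}) c :
  M T -> 0 <= c -> Alip dot A T c -> Abounded dot M A T.
Proof. by move=> MT c0 Tc; split => //; apply/Aopnorm_finP; exists c. Qed.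

Lemma AinvertibleP (T : {linear H -> H}) l :
  Ainvertible dot M A (l *: (idfun : H -> H) - (T : H -> H)) <->
  exists S : {linear H -> H}, [/\ Abounded dot M A S,
    forall x, A (l *: S x - T (S x)) = A x &
    forall x, A (S (l *: x - T x)) = A x].
Proof.
split.
  move=> [S SM [e1 e2]]; have /AboundedP[S' [SS' _ _]] := SM; subst S.
  exists S'; split => // x.
    exact: (congr1 (@^~ x) e1).
  exact: (congr1 (@^~ x) e2).
move=> [S [SM SR SL]]; exists S => //.
by split; apply/funext => x; [exact: SR|exact: SL].
Qed.

Lemma AlipZ (B : {linear H -> H}) (S : {linear H -> H}) c a : positive_op dot B ->
  Alip dot B S c -> cmod a * c <= 1 / 2 -> Alip dot B (a \*: S) (1 / 2).
Proof.
move=> B_pos Sc ac x; rewrite /= (AnormZ B_pos).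
apply: (@le_trans _ _ (cmod a * (c * Anorm dot B x))).
  by rewrite ler_wpM2l ?cmod_ge0.
by rewrite mulrA ler_wpM2r ?Anorm_ge0.
Qed.

Lemma neumann_scale (S : {linear H -> H}) c a : M S ->
  Alip dot A S c -> Alip dot idfun S c -> cmod a * c <= 1 / 2 ->
  exists W : {linear H -> H}, [/\ M W, Alip dot A W 2,
    forall x, W x - a *: S (W x) = x & forall x, W (x - a *: S x) = x].
Proof.
move=> MS SA S1 ac; apply: (neumann dot_norm vnM A_pos (X := a \*: S)).
- exact: (vna_scale vnM a MS).
- by apply: (AlipZ (B := idfun)) S1 ac; exact: idfun_pos.
- exact: AlipZ SA ac.
Qed.

(** For large [l], [l - T = l (1 - l^-1 T)] has a genuine inverse given by the
    Neumann series. *)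
Lemma Aspectrum_bounded (T : {linear H -> H}) : Abounded dot M A T ->
  exists r, Aspectrum dot M A T `<=` [set l | cmod l <= r].
Proof.
move=> /AboundedP[T' [TT' MT' [c c0 [TA T1]]]].
exists (2 * c) => l nl /=; rewrite leNgt; apply/negP => cl; apply: nl.
have TE x : T' x = T x by rewrite TT'.
have l0 : 0 < cmod l by apply: le_lt_trans cl; rewrite mulr_ge0.
have lN0 : l != 0 by apply: contraTneq l0 => ->; rewrite Normc.normc0 ltxx.
have [|W [MW WA WR WL]] := neumann_scale (a := l^-1) MT' TA T1.
  by rewrite Normc.normcV mulrC ler_pdivrMr//; lra.
apply/AinvertibleP; exists (l^-1 \*: W); split.
- apply: (Abounded_intro (c := cmod l^-1 * 2)).
  + exact: (vna_scale vnM _ MW).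
  + by rewrite mulr_ge0 ?cmod_ge0.
  + by move=> x; rewrite /= (AnormZ A_pos) -mulrA ler_wpM2l ?cmod_ge0.
- move=> x /=; rewrite [T (_ *: _)]linearZ /= scalerA mulfV// scale1r -TE.
  congr (A _).
  exact: WR.
- move=> x /=; rewrite -[l^-1 *: W _]linearZ /= scalerBr scalerA mulVf// scale1r.
  rewrite -TE; congr (A _).
  exact: WL.
Qed.

(** If [S] is an [A]-inverse of [l - T], then modulo [ker A] one has
    [(k - T) S = 1 - (l - k) S], and the exact inverse [W] of the right-hand
    side, which commutes with [S], gives the [A]-inverse [S W] of [k - T]. *)
Lemma Ainvertible_open (T : {linear H -> H}) l :
  Ainvertible dot M A (l *: (idfun : H -> H) - (T : H -> H)) ->
  exists2 d, 0 < d & forall k, cmod (l - k) < d ->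
    Ainvertible dot M A (k *: (idfun : H -> H) - (T : H -> H)).
Proof.
move=> /AinvertibleP[S [/AboundedP[S' [SS' MS [c c0 [SA S1]]]] SR SL]].
have SE x : S' x = S x by rewrite SS'.
exists (2 * (c + 1))^-1; first by rewrite invr_gt0; lra.
move=> k; rewrite -[X in _ < X]div1r ltr_pdivlMr; last lra.
move=> lk; have lk0 := cmod_ge0 (l - k).
have [|W [MW WA WR WL]] := neumann_scale (a := l - k) MS SA S1; first by lra.
have SW x : W (S x) = S (W x).
  rewrite -[RHS]WL -[in LHS](WR x) SE; congr (W _).
  by rewrite linearB linearZ /= !SE.
have kE x : k *: x - T x = (l *: x - T x) - (l - k) *: x.
  by rewrite scalerBl opprB [RHS]addrC addrA subrK.
apply/AinvertibleP; exists (S \o W); split.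
- apply: (Abounded_intro (c := c * 2)); last 2 first.
  + by rewrite mulr_ge0.
  + move=> x; rewrite /= -SE; apply: (le_trans (SA _)).
    by rewrite -mulrA ler_wpM2l.
  have MS1 : M S by rewrite SS'.
  exact: (vna_comp vnM MS1 MW).
- move=> x /=; rewrite kE linearB /= SR -SE.
  by rewrite -linearB WR.
- move=> x /=; rewrite -SW kE; rewrite -[RHS](congr1 A (WL x)).
  apply: (Alip_ker A_pos WA).
  by rewrite [S (_ - _)]linearB [A (S _ - _)]linearB /= SL linearZ /= -SE [RHS]linearB.
Qed.

End Aalgebra.

Theorem corollary2p4 (R : realType) (H : completeNormedModType R[i])
    (dot : {dot H for Num.conj}) (dot_norm : hilbert_norm dot)
    (M : set (H -> H)) (vnM : von_neumann_algebra dot M)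
    (A : H -> H) (MA : M A) (A_neq0 : A != 0) (A_pos : positive_op dot A)
    (T : H -> H) (MAT : Abounded dot M A T) :
  Aspectrum dot M A T !=set0 /\ compact (Aspectrum dot M A T).
Proof.
have [/linear_packed[A' AE] _] := vna_bounded vnM MA; subst A.
have [h0 Ah0] : exists h, A' h != 0.
  apply: contrapT => /forallNP A0; move/eqP: A_neq0; apply; apply/funext => h.
  by apply/eqP/negP => /negP; apply: A0.
have [T' [TE MT [c c0 [TA _]]]] := (AboundedP A_pos Ah0 dot_norm vnM T).1 MAT.
subst T; split.
  apply: contrapT => /set0P/negP/negPn/eqP sp0.
  apply: (resolvent_contra A_pos TA Ah0) => l.
  have : Ainvertible dot M A' (l *: (idfun : H -> H) - (T' : H -> H)).
    by apply: contrapT => nl; have : Aspectrum dot M A' T' l by []; rewrite sp0.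
  move=> /(AinvertibleP A_pos Ah0 dot_norm vnM)[S [SM SR SL]].
  have [S' [SE _ [d d0 [SA _]]]] := (AboundedP A_pos Ah0 dot_norm vnM S).1 SM.
  by exists S, d; split => //; rewrite SE.
have [r spr] := Aspectrum_bounded A_pos Ah0 dot_norm vnM MAT.
apply: subclosed_compact (@compact_cmod_le R r) spr.
rewrite -openC openE => l /= /contrapT.
move=> /(Ainvertible_open A_pos Ah0 dot_norm vnM)[d d0 hd].
apply/nbhs_cmod; exists d => // k /hd; exact: (fun x nx => nx x).
Qed.
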